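(* Let $K$ be a field, let $m\ge1$ be an integer, and let $S=K[x_1,x_2,x_3,x_4]$. Let $L(m)\subseteq\mathbb Z^4$ be the lattice generated by $$\mathbf c_1=(m+4,-(m+1),-1,-1),\quad \mathbf c_2=(-(m+1),-3,-1,m+4),\quad \mathbf c_3=(-1,m+3,-(m+1),-1),$$ and let $$\mathbf u_1=\mathbf c_1,\ \mathbf u_2=\mathbf c_2,\ \mathbf u_3=\mathbf c_3,\ \mathbf u_4=\mathbf c_1+\mathbf c_3,\ \mathbf u_5=\mathbf c_2+\mathbf c_3,\ \mathbf u_6=\mathbf c_1+\mathbf c_2+\mathbf c_3,\ \mathbf u_7=\mathbf c_1+\mathbf c_2+2\mathbf c_3.$$ Let $G=\{g_1,\dots,g_7\}\subseteq S$, where $$g_1=x_1^{m+4}-x_2^{m+1}x_3x_4,\quad g_2=x_4^{m+4}-x_1^{m+1}x_2^3x_3,\quad g_3=x_2^{m+3}-x_1x_3^{m+1}x_4,$$ $$g_4=x_1^{m+3}x_2^2-x_3^{m+2}x_4^2,\quad g_5=x_2^{m}x_4^{m+3}-x_1^{m+2}x_3^{m+2},\quad g_6=x_1^2x_4^{m+2}-x_2x_3^{m+3},$$ $$g_7=x_1x_2^{m+2}x_4^{m+1}-x_3^{2m+4}.$$ Let $\prec$ be the weighted graded reverse lexicographic order on $S$ defined in the context. Then $G$ is the reduced Gröbner basis of the lattice ideal $I_{L(m)}$ with respect to $\prec$. Moreover, $I_{L(m)}$ is generic, $G$ is the unique (up to the signs of its elements) minimal system of binomial generators of $I_{L(m)}$,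 and the set of neighbors of the origin of $L(m)$ is $$N(L(m))=\{\pm\mathbf u_i\mid 1\le i\le 7\}.$$
   Context: For $\mathbf u\in\mathbb Z^r$ let $\mathbf u^+,\mathbf u^-\in\mathbb N^r$ have coordinates $(\mathbf u^+)_i=\max\{u_i,0\}$, $(\mathbf u^-)_i=\max\{-u_i,0\}$, so $\mathbf u=\mathbf u^+-\mathbf u^-$. For a lattice (subgroup) $L\subseteq\mathbb Z^r$ the lattice ideal is $I_L=\langle \mathbf x^{\mathbf u^+}-\mathbf x^{\mathbf u^-}\mid\mathbf u\in L\rangle\subseteq K[x_1,\dots,x_r]$, where $\mathbf x^{\mathbf a}=x_1^{a_1}\cdots x_r^{a_r}$. Binomials are differences of two monomials. The support of the binomial $\mathbf x^{\mathbf u^+}-\mathbf x^{\mathbf u^-}$ is $\{i: u_i\ne0\}$, and it has full support if this is $\{1,\dots,r\}$. The ideal $I_L$ is generic if it is generated by binomials of full support. Monomial order: put $n_1=m^3+7m^2+21m+20$, $n_2=m^3+8m^2+25m+25$, $n_3=m^3+8m^2+26m+25$, $n_4=m^3+8m^2+28m+30$. For exponent vectors $\mathbf a,\mathbf b\in\mathbb N^4$, $\mathbf x^{\mathbf a}\prec\mathbf x^{\mathbf b}$ if $\sum_i a_in_i<\sum_i b_in_i$, or if $\sum_i a_in_i=\sum_i b_in_i$ and the last nonzero coordinate of $(a_1-b_1,\,a_2-b_2,\,a_4-b_4,\,a_3-b_3)$ is positive (so $x_3$ is the smallest variable in the reverse lexicographic tie-break). Neighbors of the origin: for a nonempty finite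 subset $J\subseteq L$, $\max(J)$ is the coordinatewise maximum of the elements of $J$. Let $\Delta_L$ be the collection of finite subsets $J\subseteq L$ such that $\max(J)\ne\max(J')$ for every finite subset $J'\subseteq L$ with $J'\ne J$. A vector $\mathbf u\in L\setminus\{\mathbf 0\}$ is a neighbor of the origin if $\{\mathbf 0,\mathbf u\}\in\Delta_L$; $N(L)$ denotes the set of all neighbors of the origin. *)

(* Defs.v *)
From HB Require Import structures.
From mathcomp Require Import all_boot all_order all_algebra.
From mathcomp Require Import finmap.
From mathcomp.multinomials Require Import mpoly.

Set Implicit Arguments.
Unset Strict Implicit.
Unset Printing Implicit Defensive.

Import Order.TTheory GRing.Theory Num.Theory.
Local Open Scope ring_scope.

Section Ideals.
Variables (K : fieldType) (r : nat).
Local Notation S := {mpoly K[r]}.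
Implicit Types (B I : S -> Prop) (f b : S).

Definition ideal_gen B f : Prop :=
  exists2 s : seq (S * S),
    (forall p, p \in s -> B p.2) & f = \sum_(p <- s) p.1 * p.2.

Definition generates B I : Prop := forall f, I f <-> ideal_gen B f.

Definition is_binomial b : Prop :=
  exists a c : 'X_{1..r}, b = 'X_[a] - 'X_[c].

(* Minimality is with respect to inclusion; [B] is not assumed finite. *)
Definition minimal_binomial_generators I B : Prop :=
  [/\ forall b, B b -> is_binomial b,
      generates B I
    & forall B' : S -> Prop, (forall b, B' b -> B b) -> generates B' I ->
        forall b, B b -> B' b].

End Ideals.

Section Groebner.
Variables (K : fieldType) (r : nat).
Local Notation S := {mpoly K[r]}.
(* [lt] is the strict monomial order. The library's [mlead] is tied to its own
   fixed order, hence the relational leading monomial below. *)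
Variable lt : rel 'X_{1..r}.
Implicit Types (I P : S -> Prop) (f g q : S) (G : seq S).

Definition leading_monomial f (a : 'X_{1..r}) : Prop :=
  a \in msupp f /\ forall b, b \in msupp f -> b != a -> lt b a.

Definition leading_monomials P q : Prop :=
  exists f a, [/\ P f, leading_monomial f a & q = 'X_[a]].

Definition initial_ideal I : S -> Prop := ideal_gen (leading_monomials I).

Definition groebner_basis I G : Prop :=
  (forall g, g \in G -> I g /\ g != 0) /\
  generates (leading_monomials (fun g => g \in G)) (initial_ideal I).

Definition reduced_groebner_basis I G : Prop :=
  [/\ groebner_basis I G,
      forall g a, g \in G -> leading_monomial g a -> g@_a = 1
    & forall g h a b, g \in G -> h \in G -> g != h ->
        leading_monomial g a -> b \in msupp h -> ~~ (a <= b)%MM].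

End Groebner.

Section Lattices.
Variables (K : fieldType) (r : nat).
Implicit Types (L : 'rV[int]_r -> Prop) (u : 'rV[int]_r).

Definition pos_part u : 'X_{1..r} := [multinom absz (Num.max (u 0 i) 0)%R | i < r].
Definition neg_part u : 'X_{1..r} :=
  [multinom absz (Num.max (- u 0 i) 0)%R | i < r].

Definition lattice_binomial u : {mpoly K[r]} :=
  'X_[pos_part u] - 'X_[neg_part u].

Definition lattice_ideal L : {mpoly K[r]} -> Prop :=
  ideal_gen (fun b => exists2 u, L u & b = lattice_binomial u).

Definition full_support_binomial (b : {mpoly K[r]}) : Prop :=
  exists2 u, b = lattice_binomial u & forall i, u 0 i != 0.

Definition generic_lattice_ideal L : Prop :=
  exists2 B : {mpoly K[r]} -> Prop,
    (forall b, B b -> full_support_binomial b) & generates B (lattice_ideal L).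

End Lattices.

Section Neighbors.
Variable r : nat.
Implicit Types (L : 'rV[int]_r -> Prop) (u : 'rV[int]_r)
  (J : {fset 'rV[int]_r}).

(* The default value of the big maximum is itself an entry of an element of [J]
   when [J] is nonempty; [coord_max fset0 = 0] is junk. *)
Definition coord_max J : 'rV[int]_r :=
  \row_i \big[Num.max/(head 0 (enum_fset J)) 0 i]_(v <- enum_fset J) v 0 i.

Definition nonempty_finite_subset L J : Prop :=
  J != fset0 /\ forall v, v \in J -> L v.

Definition Delta L J : Prop :=
  nonempty_finite_subset L J /\
  forall J', nonempty_finite_subset L J' -> J' != J ->
    coord_max J != coord_max J'.

Definition neighbor_of_origin L u : Prop :=
  [/\ L u, u != 0 & Delta L [fset 0; u]%fset].

End Neighbors.

Definition i1 : 'I_4 := @Ordinal 4 0 isT.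
Definition i2 : 'I_4 := @Ordinal 4 1 isT.
Definition i3 : 'I_4 := @Ordinal 4 2 isT.
Definition i4 : 'I_4 := @Ordinal 4 3 isT.

Section Family.
Variable m : nat.

Definition n1 : nat := (m ^ 3 + 7 * m ^ 2 + 21 * m + 20)%N.
Definition n2 : nat := (m ^ 3 + 8 * m ^ 2 + 25 * m + 25)%N.
Definition n3 : nat := (m ^ 3 + 8 * m ^ 2 + 26 * m + 25)%N.
Definition n4 : nat := (m ^ 3 + 8 * m ^ 2 + 28 * m + 30)%N.

Definition weighted_degree (a : 'X_{1..4}) : nat :=
  (a i1 * n1 + a i2 * n2 + a i3 * n3 + a i4 * n4)%N.

(* The last nonzero entry of [s], or 0 if there is none. *)
Definition last_nonzero (s : seq int) : int := last 0 [seq x <- s | x != 0].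

(* The third and fourth coordinates are swapped, so that x_3 is the smallest
   variable of the tie-break. *)
Definition wrevlex_lt : rel 'X_{1..4} := fun a b =>
  (weighted_degree a < weighted_degree b)%N ||
  (weighted_degree a == weighted_degree b) &&
  (0 < last_nonzero [:: (a i1)%:Z - (b i1)%:Z; (a i2)%:Z - (b i2)%:Z;
                        (a i4)%:Z - (b i4)%:Z; (a i3)%:Z - (b i3)%:Z]).

Definition vec4 (a b c d : int) : 'rV[int]_4 := \row_j [:: a; b; c; d]`_j.

Definition c1 := vec4 (m + 4)%:Z (- (m + 1)%:Z) (- 1) (- 1).
Definition c2 := vec4 (- (m + 1)%:Z) (- 3) (- 1) (m + 4)%:Z.
Definition c3 := vec4 (- 1) (m + 3)%:Z (- (m + 1)%:Z) (- 1).

Definition Lm (u : 'rV[int]_4) : Prop :=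
  exists k1 k2 k3 : int, u = k1 *: c1 + k2 *: c2 + k3 *: c3.

Definition us : seq 'rV[int]_4 :=
  [:: c1; c2; c3; c1 + c3; c2 + c3; c1 + c2 + c3; c1 + c2 + c3 *+ 2].

Variable K : fieldType.
Local Notation x1 := ('X_i1 : {mpoly K[4]}).
Local Notation x2 := ('X_i2 : {mpoly K[4]}).
Local Notation x3 := ('X_i3 : {mpoly K[4]}).
Local Notation x4 := ('X_i4 : {mpoly K[4]}).

Definition g1 : {mpoly K[4]} :=
  x1 ^+ (m + 4) - x2 ^+ (m + 1) * x3 * x4.
Definition g2 : {mpoly K[4]} :=
  x4 ^+ (m + 4) - x1 ^+ (m + 1) * x2 ^+ 3 * x3.
Definition g3 : {mpoly K[4]} :=
  x2 ^+ (m + 3) - x1 * x3 ^+ (m + 1) * x4.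
Definition g4 : {mpoly K[4]} :=
  x1 ^+ (m + 3) * x2 ^+ 2 - x3 ^+ (m + 2) * x4 ^+ 2.
Definition g5 : {mpoly K[4]} :=
  x2 ^+ m * x4 ^+ (m + 3) - x1 ^+ (m + 2) * x3 ^+ (m + 2).
Definition g6 : {mpoly K[4]} :=
  x1 ^+ 2 * x4 ^+ (m + 2) - x2 * x3 ^+ (m + 3).
Definition g7 : {mpoly K[4]} :=
  x1 * x2 ^+ (m + 2) * x4 ^+ (m + 1) - x3 ^+ (2 * m + 4).

Definition Gm : seq {mpoly K[4]} := [:: g1; g2; g3; g4; g5; g6; g7].

End Family.

(* Main.v *)
Require Import Defs.
From HB Require Import structures.
From mathcomp Require Import all_boot all_order all_algebra.
From mathcomp Require Import finmap zify.
From mathcomp.multinomials Require Import mpoly.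
From Stdlib Require Import ClassicalEpsilon.

Set Implicit Arguments.
Unset Strict Implicit.
Unset Printing Implicit Defensive.

Import Order.TTheory GRing.Theory Num.Theory.
Local Open Scope ring_scope.

(* For a binomial [x^u+ - x^u-] of the lattice ideal with [u_3 <= 0], one of the
   leading monomials [x^u_i+] divides [x^u+]: otherwise [u = k1 c1 + k2 c2 + k3 c3]
   lies in a box that contains only twelve candidates for [(k1, k2, k3)], and these
   are checked one by one. As every element of the lattice ideal has coefficients
   summing to 0 on each congruence class of monomials modulo [L], this
   divisibility gives the Groebner basis. Since each [u_i] has full support,
   subtracting [u_i] from [u] creates a common factor, so the weighted degree
   drops and the [g_i] generate the ideal. The same box shows that
   [w <= u_i^+] with [w] in [L] forces [w = 0] or [w = u_i]: the fibre of [x^u_i+]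
   has two elements, so every binomial generating set contains [g_i] or [-g_i],
   and the [u_i] are neighbors of the origin. *)

(** * Ideals generated by a set of polynomials *)

Section IdealGen.
Variables (K : fieldType) (r : nat).
Implicit Types (B : {mpoly K[r]} -> Prop) (f g : {mpoly K[r]}).

Lemma ideal_gen_in B f : B f -> ideal_gen B f.
Proof.
move=> Bf; exists [:: (1, f)]; last by rewrite big_seq1 mul1r.
by move=> p; rewrite inE => /eqP->.
Qed.

Lemma ideal_gen0 B : ideal_gen B 0.
Proof. by exists [::] => //; rewrite big_nil. Qed.

Lemma ideal_genD B f g : ideal_gen B f -> ideal_gen B g -> ideal_gen B (f + g).
Proof.
move=> [s Bs ->] [t Bt ->]; exists (s ++ t); last by rewrite big_cat.
by move=> p; rewrite mem_cat => /orP[/Bs|/Bt].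
Qed.

Lemma ideal_genMl B f g : ideal_gen B g -> ideal_gen B (f * g).
Proof.
move=> [s Bs ->]; exists [seq (f * p.1, p.2) | p <- s].
  by move=> _ /mapP[p /Bs ? ->].
by rewrite big_map mulr_sumr; apply: eq_bigr => p _ /=; rewrite mulrA.
Qed.

Lemma ideal_genN B f : ideal_gen B f -> ideal_gen B (- f).
Proof. by rewrite -mulN1r; apply: ideal_genMl. Qed.

Lemma ideal_gen_sub B B' f :
  (forall b, B b -> ideal_gen B' b) -> ideal_gen B f -> ideal_gen B' f.
Proof.
move=> BB' [s Bs ->]; elim: s Bs => [|p s IHs] Bs.
  by rewrite big_nil; apply: ideal_gen0.
rewrite big_cons; apply: ideal_genD.
  by apply/ideal_genMl/BB'/Bs; rewrite mem_head.
by apply: IHs => q sq; apply: Bs; rewrite inE sq orbT.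
Qed.

End IdealGen.

(** * Positive and negative parts of integer vectors, and divisibility of monomials *)

Section ExponentVectors.
Variable r : nat.
Implicit Types (u v w : 'rV[int]_r) (a b : 'X_{1..r}).

Definition mnm_vec a : 'rV[int]_r := \row_i (a i)%:Z.

Lemma pos_partE u i : pos_part u i = absz (Num.max (u 0 i) 0).
Proof. by rewrite mnmE. Qed.

Lemma neg_partE u i : neg_part u i = absz (Num.max (- u 0 i) 0).
Proof. by rewrite mnmE. Qed.

Lemma pos_partN u : pos_part (- u) = neg_part u.
Proof. by apply/mnmP => i; rewrite pos_partE neg_partE !mxE. Qed.

Lemma neg_partN u : neg_part (- u) = pos_part u.
Proof. by rewrite -pos_partN opprK. Qed.

Lemma mnm_vec_inj : injective mnm_vec.
Proof. by move=> a b /rowP E; apply/mnmP => i; have := E i; rewrite !mxE => -[]. Qed.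

Lemma mnm_vecD a b : mnm_vec (a + b)%MM = mnm_vec a + mnm_vec b.
Proof. by apply/rowP => i; rewrite !mxE mnmDE. Qed.

Lemma pos_part_sub_neg u : mnm_vec (pos_part u) - mnm_vec (neg_part u) = u.
Proof. by apply/rowP => i; rewrite !mxE pos_partE neg_partE; move: (u 0 i) => x; lia. Qed.

Lemma pos_part_leP u v :
  reflect (forall i, u 0 i <= Num.max (v 0 i) 0) (pos_part u <= pos_part v)%MM.
Proof.
by apply: (iffP mnm_lepP) => H i; have := H i; rewrite !pos_partE; lia.
Qed.

Lemma pos_part_sub_le a b : (pos_part (mnm_vec a - mnm_vec b)%R <= a)%MM.
Proof. by apply/mnm_lepP => i; rewrite pos_partE !mxE; lia. Qed.

Lemma pos_neg_disjoint u a :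
  (a <= pos_part u)%MM -> (a <= neg_part u)%MM -> a = 0%MM.
Proof.
move=> /mnm_lepP p /mnm_lepP q; apply/mnmP => i; rewrite mnm0E.
by have := p i; have := q i; rewrite pos_partE neg_partE; lia.
Qed.

Lemma pos_neg_neq u : u != 0 -> pos_part u != neg_part u.
Proof.
by apply: contra_neq => E; rewrite -[u]pos_part_sub_neg E subrr.
Qed.

End ExponentVectors.

(** * Differences of two monomials *)

Section Binomials.
Variables (K : fieldType) (r : nat).
Local Notation S := {mpoly K[r]}.
Implicit Types (u v : 'rV[int]_r) (a b c : 'X_{1..r}).

Lemma lattice_binomialN u : lattice_binomial K (- u) = - lattice_binomial K u.
Proof. by rewrite /lattice_binomial pos_partN neg_partN opprB. Qed.

Lemma lattice_binomial0 : lattice_binomial K (0 : 'rV[int]_r) = 0.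
Proof.
rewrite /lattice_binomial (_ : pos_part 0 = neg_part 0) ?subrr //.
by rewrite -pos_partN oppr0.
Qed.

(** Factors out the greatest common divisor of the two monomials; the cofactor is the binomial of
    the difference of the exponents. *)
Lemma mpolyX_sub a b :
  'X_[a] - 'X_[b] = 'X_[[multinom minn (a i) (b i) | i < r]]
    * lattice_binomial K (mnm_vec a - mnm_vec b) :> S.
Proof.
rewrite mulrBr -!mpolyXD; congr ('X_[_] - 'X_[_]); apply/mnmP => i;
  by rewrite mnmDE ?pos_partE ?neg_partE !mxE mnmE; lia.
Qed.

Lemma msupp_binomial a b c : c \in msupp ('X_[a] - 'X_[b] : S) -> c = a \/ c = b.
Proof.
move/msuppB_le; rewrite mem_cat !msuppX !inE.
by case/orP=> /eqP ->; [left | right].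
Qed.

Lemma mcoeff_binomial a b : a != b -> ('X_[a] - 'X_[b] : S)@_a = 1.
Proof.
by move=> ab; rewrite mcoeffB !mcoeffX eqxx eq_sym (negbTE ab) subr0.
Qed.

Lemma msupp_binomialE a b c : a != b ->
  (c \in msupp ('X_[a] - 'X_[b] : S)) = (c == a) || (c == b).
Proof.
move=> ab; apply/idP/orP => [/msupp_binomial[]->|]; first by left.
  by right.
case=> /eqP ->; rewrite mcoeff_msupp ?mcoeff_binomial ?oner_eq0 //.
by rewrite mcoeffB !mcoeffX eqxx (negbTE ab) sub0r oppr_eq0 oner_eq0.
Qed.

End Binomials.

(** * Coefficient sums over congruence classes modulo a lattice *)

Section LatticeIdeal.
Variables (K : fieldType) (r : nat) (L : 'rV[int]_r -> Prop).
Hypothesis L0 : L 0.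
Hypothesis LB : forall u v, L u -> L v -> L (u - v).
Local Notation S := {mpoly K[r]}.
Local Notation I := (lattice_ideal (K := K) L).
Implicit Types (f g : S) (a b c : 'X_{1..r}) (u v w : 'rV[int]_r).

Lemma lattice_opp u : L u -> L (- u).
Proof. by move=> Lu; rewrite -sub0r; apply: LB. Qed.

Lemma lattice_add u v : L u -> L v -> L (u + v).
Proof. by move=> Lu Lv; rewrite -[v]opprK; apply: LB => //; apply: lattice_opp. Qed.

(** [L] is a [Prop]-valued predicate; excluded middle makes it Boolean, so that it can serve as a
    0-1 weight in a sum. *)
Definition congruent a b : bool :=
  if excluded_middle_informative (L (mnm_vec b - mnm_vec a)) then true else false.

Lemma congruentP a b : reflect (L (mnm_vec b - mnm_vec a)) (congruent a b).
Proof.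
by rewrite /congruent; case: excluded_middle_informative => H; constructor.
Qed.

(** The coefficient at the class of [a] of the image of [f] in the group algebra of Z^r modulo
    [L]. *)
Definition class_sum a f : K := \sum_(b <- msupp f) f@_b * (congruent a b)%:R.

(** Allows two polynomials to be summed over a common list of exponents, which is how additivity is
    proved. *)
Lemma class_sum_widen a f (s : seq 'X_{1..r}) : uniq s -> {subset msupp f <= s} ->
  class_sum a f = \sum_(b <- s) f@_b * (congruent a b)%:R.
Proof.
move=> us fs; rewrite [RHS](bigID (fun b => b \in msupp f)) /=.
rewrite [X in _ + X]big1 ?addr0 => [|b]; last first.
  by rewrite -mcoeff_eq0 => /eqP->; rewrite mul0r.
rewrite -[RHS]big_filter; apply: perm_big; apply: uniq_perm.
- exact: msupp_uniq.
- exact: filter_uniq.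
- by move=> b; rewrite mem_filter; case: (boolP (b \in msupp f)) => // /fs.
Qed.

Lemma class_sumD a f g : class_sum a (f + g) = class_sum a f + class_sum a g.
Proof.
pose s := undup (msupp f ++ msupp g).
have us : uniq s by apply: undup_uniq.
rewrite !(@class_sum_widen a _ s) //; first last.
- by move=> b; rewrite mem_undup; apply: msuppD_le.
- by move=> b; rewrite mem_undup mem_cat => ->.
- by move=> b; rewrite mem_undup mem_cat => ->; rewrite orbT.
by rewrite -big_split /=; apply: eq_bigr => b _; rewrite mcoeffD mulrDl.
Qed.

Lemma class_sumZX a c (k : K) : class_sum a (k *: 'X_[c]) = k * (congruent a c)%:R.
Proof.
rewrite (@class_sum_widen a _ [:: c]) //.
  by rewrite big_seq1 mcoeffZ mcoeffX eqxx mulr1.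
by move=> b /msuppZ_le; rewrite msuppX.
Qed.

Lemma class_sum0 a : class_sum a 0 = 0.
Proof. by rewrite /class_sum msupp0 big_nil. Qed.

(** A monomial times a lattice binomial has its two terms in one class, with opposite
    coefficients. *)
Lemma class_sumM_binomial a f u : L u -> class_sum a (f * lattice_binomial K u) = 0.
Proof.
move=> Lu; rewrite [f]mpolyE mulr_suml (big_morph _ (class_sumD a) (class_sum0 a)).
apply: big1 => c _; rewrite -scalerAl mulrBr -!mpolyXD scalerBr -scaleNr.
rewrite class_sumD !class_sumZX mulNr; apply/eqP; rewrite subr_eq0; apply/eqP.
congr (_ * (nat_of_bool _)%:R).
have E : mnm_vec (c + pos_part u)%MM = mnm_vec (c + neg_part u)%MM + u.
  rewrite !mnm_vecD -addrA [_ + u]addrC; congr (_ + _).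
  by apply/eqP; rewrite -subr_eq pos_part_sub_neg.
apply/congruentP/congruentP => H.
  by have := LB H Lu; rewrite E (addrAC _ u) addrK.
by rewrite E addrAC; apply: lattice_add.
Qed.

Lemma lattice_ideal_class_sum f a : I f -> class_sum a f = 0.
Proof.
case=> s sB ->; rewrite (big_morph _ (class_sumD a) (class_sum0 a)).
apply: big1_seq => p /= /sB [u Lu ->]; exact: class_sumM_binomial.
Qed.

(** If [a] were alone in its class within the support, the class sum would be its nonzero
    coefficient, whereas it vanishes on the ideal. *)
Lemma lattice_ideal_partner f a : I f -> a \in msupp f ->
  exists b, [/\ b \in msupp f, b != a & L (mnm_vec a - mnm_vec b)].
Proof.
move=> If fa; have := lattice_ideal_class_sum a If.
have [/hasP[b fb /andP[ba /congruentP Lab]] _|/hasPn no] :=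
    boolP (has (fun b => (b != a) && congruent a b) (msupp f)).
  by exists b; split=> //; rewrite -opprB; apply: lattice_opp.
rewrite /class_sum (bigD1_seq a) ?msupp_uniq //= big1_seq => [|b /andP[ba fb]].
  rewrite addr0 (_ : congruent a a) ?mulr1; last by apply/congruentP; rewrite subrr.
  by move/eqP; rewrite mcoeff_eq0 fa.
by have := no b fb; rewrite ba /= => /negbTE->; rewrite mulr0.
Qed.

(** The only possible partner of [a] in the support is [b]. *)
Lemma lattice_ideal_binomialP a b :
  I ('X_[a] - 'X_[b]) -> L (mnm_vec a - mnm_vec b).
Proof.
have [->|ab] := eqVneq a b; first by move=> _; rewrite subrr.
move=> Iab; case: (lattice_ideal_partner (a := a) Iab).
  by rewrite msupp_binomialE // eqxx.
move=> c []; rewrite msupp_binomialE // => /orP[]/eqP-> //.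
by rewrite eqxx.
Qed.

Lemma lattice_binomial_in u : L u -> I (lattice_binomial K u).
Proof. by move=> Lu; apply: ideal_gen_in; exists u. Qed.

End LatticeIdeal.

(** * Coordinatewise maxima and neighbors of the origin *)

Section CoordinatewiseMaximum.
Variable r : nat.
Implicit Types (L : 'rV[int]_r -> Prop) (u v w : 'rV[int]_r)
  (J : {fset 'rV[int]_r}).

Lemma coord_max_ub J v i : v \in J -> v 0 i <= coord_max J 0 i.
Proof.
rewrite mxE -[v \in J]/(v \in enum_fset J); elim: (enum_fset J) (head _ _) => //= x s IHs y.
rewrite inE big_cons le_max => /predU1P[->|sv]; first by rewrite lexx.
by rewrite IHs ?orbT.
Qed.

Lemma coord_max_le J i (x : int) :
  J != fset0 -> (forall v, v \in J -> v 0 i <= x) -> coord_max J 0 i <= x.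
Proof.
move=> J0 Jx; rewrite mxE.
(* The big maximum starts from an entry of the first element of [J], so this default value must be
   bounded too. *)
have : head 0 (enum_fset J) 0 i <= x.
  apply: Jx; case/fset0Pn: J0 => v; rewrite -[v \in J]/(v \in enum_fset J).
  rewrite -[head _ _ \in J]/(head _ _ \in enum_fset J).
  by case: (enum_fset J) => //= y s _; rewrite mem_head.
move: (fun_of_matrix (head 0 _) 0 i) => y yx; rewrite big_seq.
by elim/big_ind: _ => // a b ax bx; rewrite ge_max ax bx.
Qed.

Lemma coord_max_pair u i : coord_max [fset 0; u]%fset 0 i = Num.max (u 0 i) 0.
Proof.
apply/le_anti/andP; split.
  apply: coord_max_le => [|v]; first by apply/fset0Pn; exists 0; rewrite fset21.
  by rewrite !inE => /orP[]/eqP->; rewrite ?mxE le_max lexx ?orbT.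
rewrite ge_max coord_max_ub ?fset22 //=.
by have := coord_max_ub i (fset21 0 u); rewrite mxE.
Qed.

(** Adding to [[fset 0; u]] a vector below its maximum leaves the maximum unchanged. Conversely, a
    set with the same maximum has no elements other than 0 and [u]; the positive entry of [u] forces
    it to contain [u], the negative one to contain 0. *)
Lemma neighbor_of_originP L u : L 0 ->
  (exists i, u 0 i < 0) -> (exists i, 0 < u 0 i) ->
  neighbor_of_origin L u <->
  [/\ L u, u != 0
    & forall w, L w -> (forall i, w 0 i <= Num.max (u 0 i) 0) -> w = 0 \/ w = u].
Proof.
move=> L0 [i ui] [j uj].
have J0 : [fset 0; u]%fset != fset0 by apply/fset0Pn; exists 0; rewrite fset21.
split=> [[Lu u0 [_ D]]|[Lu u0 H]]; split=> //.
  move=> w Lw wu; have [->|w0] := eqVneq w 0; [by left|right].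
  have [//|wnu] := eqVneq w u.
  pose J' := (w |` [fset 0; u])%fset.
  suff: coord_max [fset 0; u]%fset != coord_max J'.
    case/eqP; apply/rowP => l; rewrite coord_max_pair; apply/le_anti/andP; split.
      rewrite -coord_max_pair; apply: coord_max_le => // v Jv.
      by apply: coord_max_ub; rewrite inE Jv orbT.
    apply: coord_max_le => [|v].
      by apply/fset0Pn; exists w; rewrite fset1U1.
    rewrite !inE => /or3P[]/eqP-> //; first by rewrite mxE le_max lexx orbT.
    by rewrite le_max lexx.
  apply: D.
    split; first by apply/fset0Pn; exists w; rewrite fset1U1.
    by move=> v; rewrite !inE => /or3P[]/eqP->.
  apply/eqP => E; have : w \in J' by rewrite fset1U1.
  by rewrite E !inE (negbTE w0) (negbTE wnu).
split=> [|J' [J'0 LJ'] J'J].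
  by split=> // v; rewrite !inE => /orP[]/eqP->.
apply/eqP => E.
have J'sub v : v \in J' -> v = 0 \/ v = u.
  move=> Jv; apply: H => [|l]; first exact: LJ'.
  by rewrite -coord_max_pair E coord_max_ub.
have [J'u|J'u] := boolP (u \in J'); last first.
  suff: coord_max J' 0 j <= 0 by rewrite -E coord_max_pair; lia.
  apply: coord_max_le => // v Jv; case: (J'sub v Jv) => vE; first by rewrite vE mxE.
  by rewrite -vE Jv in J'u.
have [J'z|J'z] := boolP (0 \in J'); last first.
  suff: coord_max J' 0 i <= u 0 i by rewrite -E coord_max_pair; lia.
  apply: coord_max_le => // v Jv; case: (J'sub v Jv) => vE; last by rewrite vE.
  by rewrite -vE Jv in J'z.
case/eqP: J'J; apply/fsetP => v; rewrite !inE; apply/idP/orP => [/J'sub[]->|].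
- by left.
- by right.
- by case=> /eqP->.
Qed.

End CoordinatewiseMaximum.

(** * Generators, neighbors and Groebner basis from a covering set [U] of full support *)

Section GenericLattice.
Variables (K : fieldType) (r : nat) (L : 'rV[int]_r -> Prop).
Variables (omega : 'I_r -> nat) (U : seq 'rV[int]_r).
Hypothesis L0 : L 0.
Hypothesis LB : forall u v, L u -> L v -> L (u - v).
Hypothesis omega_gt0 : forall i, (0 < omega i)%N.
(** A positive grading: with x_i in degree [omega i], every lattice binomial is homogeneous. *)
Hypothesis omega_L : forall u, L u -> \sum_i (omega i)%:Z * u 0 i = 0.
Hypothesis U_L : forall v, v \in U -> L v.
Hypothesis U_full : forall v, v \in U -> forall i, v 0 i != 0.
Hypothesis U_neq0 : forall v, v \in U -> v != 0.
Hypothesis U_cover : forall u, L u -> u != 0 ->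
  exists2 v, v \in U & (pos_part v <= pos_part u)%MM \/ (pos_part v <= neg_part u)%MM.
(** In terms of the exponent v^+ - w, this says that x^v+ and x^v- are the only monomials in the
    fibre of x^v+. *)
Hypothesis U_fiber : forall v w, v \in U -> L w ->
  (forall i, w 0 i <= Num.max (v 0 i) 0) -> w = 0 \/ w = v.
Local Notation S := {mpoly K[r]}.
Local Notation I := (lattice_ideal (K := K) L).
Local Notation G := [seq lattice_binomial K v | v <- U].
Implicit Types (f g : S) (a b c : 'X_{1..r}) (u v w : 'rV[int]_r).

(** If all entries were nonnegative, the vanishing sum with positive weights would make every entry
    zero. *)
Lemma lattice_neg_entry u : L u -> u != 0 -> exists i, u 0 i < 0.
Proof.
move=> Lu; have [/existsP[i ui] _|/existsPn no /eqP[]] := boolP [exists i, u 0 i < 0].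
  by exists i.
have ge0 i : true -> 0 <= (omega i)%:Z * u 0 i.
  by move=> _; rewrite mulr_ge0 // leNgt no.
apply/rowP => i; have /(_ i isT)/eqP := psumr_eq0P ge0 (omega_L Lu).
rewrite mulf_eq0 mxE => /orP[/eqP E|/eqP //].
by have := omega_gt0 i; lia.
Qed.

Lemma lattice_pos_entry u : L u -> u != 0 -> exists i, 0 < u 0 i.
Proof.
move=> Lu u0; have [||i] := @lattice_neg_entry (- u).
- exact: lattice_opp.
- by rewrite oppr_eq0.
- by rewrite mxE oppr_lt0 => ui; exists i.
Qed.

(** The [omega]-degree of x^u+; for [u] in [L] it is also the degree of x^u-, which is the content
    of [wtN]. *)
Definition wt u : int := \sum_i (omega i)%:Z * (pos_part u i)%:Z.

Lemma wt_ge0 u : 0 <= wt u.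
Proof. by apply: sumr_ge0 => i _; rewrite mulr_ge0. Qed.

Lemma wtN u : L u -> wt (- u) = wt u.
Proof.
move=> Lu; apply/eqP; rewrite eq_sym -subr_eq0 -sumrB -[X in _ == X](omega_L Lu).
apply/eqP; apply: eq_bigr => i _; rewrite -mulrBr; congr (_ * _).
by rewrite !pos_partE mxE; move: (u 0 i) => x; lia.
Qed.

(* At a coordinate where [u] is negative, full support makes [v] negative too,
   so the two monomials of the reduced binomial acquire a common factor. *)
Lemma wt_sub_lt u v : L u -> u != 0 -> v \in U ->
  (pos_part v <= pos_part u)%MM -> wt (u - v) < wt u.
Proof.
move=> Lu u0 Uv /pos_part_leP vu; have [k uk] := lattice_neg_entry Lu u0.
have E : wt u - wt (u - v) =
    \sum_i (omega i)%:Z * ((pos_part u i)%:Z - (pos_part (u - v) i)%:Z - v 0 i).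
  rewrite -[LHS]subr0 -[X in _ - X = _](omega_L (U_L Uv)) /wt -!sumrB.
  apply: eq_bigr => i _.
  by rewrite -!mulrBr.
rewrite -subr_gt0 E (bigD1 k) //= ltr_pwDl //.
  rewrite mulr_gt0 ?ltz_nat ?omega_gt0 //.
  have := vu k; have := U_full Uv k; move: uk; rewrite !pos_partE !mxE.
  by move: (u 0 k) (v 0 k) => x y; lia.
apply: sumr_ge0 => i _; rewrite mulr_ge0 //.
have := vu i; rewrite !pos_partE !mxE.
by move: (u 0 i) (v 0 i) => x y; lia.
Qed.

(** With a = u^+ - v^+, the binomial x^u+ - x^u- is x^a (x^v+ - x^v-) plus x^(a + v-) - x^u-, and
    this last difference is a monomial times the binomial of [u - v]. *)
Lemma lattice_binomial_step u v : (pos_part v <= pos_part u)%MM ->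
  exists c d, lattice_binomial K u =
    'X_[c] * lattice_binomial K v + 'X_[d] * lattice_binomial K (u - v).
Proof.
move=> vu; set a := (pos_part u - pos_part v)%MM.
have aE : pos_part u = (a + pos_part v)%MM by rewrite submK.
have wE : mnm_vec (a + neg_part v)%MM - mnm_vec (neg_part u) = u - v.
  apply/rowP => i; have /mnmP/(_ i) := aE.
  rewrite !mxE !mnmDE !pos_partE !neg_partE.
  by move: (u 0 i) (v 0 i) (a i) => x y z; lia.
(* The second multiplier is the greatest common divisor of the two monomials of the remaining
   difference. *)
exists a, [multinom minn ((a + neg_part v)%MM i) (neg_part u i) | i < r].
rewrite -wE -mpolyX_sub mulrBr -!mpolyXD -aE.
by rewrite addrA subrK.
Qed.

(** Strong induction on the degree: each reduction by an element of [U] lowers it. *)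
Lemma lattice_binomial_gen u : L u -> ideal_gen (fun g => g \in G) (lattice_binomial K u).
Proof.
have [n] := ubnP `|wt u|%N; elim: n u => // n IHn u un Lu.
have step w : (`|wt w| < n.+1)%N -> L w -> w != 0 ->
    (exists2 v, v \in U & (pos_part v <= pos_part w)%MM) ->
    ideal_gen (fun g => g \in G) (lattice_binomial K w).
  move=> wn Lw w0 [v Uv vw]; have [c [d ->]] := lattice_binomial_step vw.
  apply: ideal_genD; apply: ideal_genMl.
    by apply: ideal_gen_in; apply: map_f.
  apply: IHn; last by apply: LB => //; apply: U_L.
  have := wt_sub_lt Lw w0 Uv vw; have := wt_ge0 (w - v); have := wt_ge0 w.
  by move: (wt _) (wt _) wn => x y; lia.
have [->|u0] := eqVneq u 0; first by rewrite lattice_binomial0; apply: ideal_gen0.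
have [v Uv [vu|vu]] := U_cover Lu u0.
  by apply: step => //; exists v.
(* Here x^v+ divides x^u-: pass to [- u], which has the same degree. *)
rewrite -[u]opprK lattice_binomialN; apply: ideal_genN; apply: step.
- by rewrite wtN.
- exact: lattice_opp.
- by rewrite oppr_eq0.
- by exists v; rewrite // pos_partN.
Qed.

Lemma lattice_ideal_generated : generates (fun g => g \in G) I.
Proof.
move=> f; split; apply: ideal_gen_sub => b.
  by case=> u Lu ->; apply: lattice_binomial_gen.
by case/mapP=> v Uv ->; apply: lattice_binomial_in; apply: U_L.
Qed.

Lemma lattice_ideal_generic : generic_lattice_ideal K L.
Proof.
exists (fun g => g \in G); last exact: lattice_ideal_generated.
by move=> b /mapP[v Uv ->]; exists v => //; apply: U_full.
Qed.

Lemma pos_part_fiber v a : v \in U -> L (mnm_vec (pos_part v) - mnm_vec a) ->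
  a = pos_part v \/ a = neg_part v.
Proof.
move=> Uv La; case: (U_fiber Uv La) => [i|/eqP|E].
- by rewrite !mxE pos_partE; move: (v 0 i) => x; lia.
- by rewrite subr_eq0 => /eqP/mnm_vec_inj->; left.
right; apply: mnm_vec_inj.
by rewrite -[LHS](subKr (mnm_vec (pos_part v))) E -{2}[v]pos_part_sub_neg subKr.
Qed.

(** Each monomial of [f] contributes two terms of opposite sign, which meet x^p either both or not
    at all. *)
Lemma mcoeffM_binomial f a b p :
  (forall c, (c + a)%MM = p <-> (c + b)%MM = p) -> (f * ('X_[a] - 'X_[b]))@_p = 0.
Proof.
move=> ab; rewrite [f]mpolyE mulr_suml raddf_sum; apply: big1 => c _.
rewrite -scalerAl mulrBr -!mpolyXD /= mcoeffZ mcoeffB !mcoeffX.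
rewrite (_ : (_ == p) = ((c + b)%MM == p)) ?subrr ?mulr0 //.
by apply/eqP/eqP => /ab.
Qed.

(** Otherwise no generator could contribute to the coefficient of x^v+, which is 1: in the
    two-element fibre a contributing multiple of a generator is x^v+ - x^v- up to sign, and
    coprimality of the two monomials makes the multiplier 1. *)
Lemma generators_contain (B : S -> Prop) v :
  (forall g, B g -> is_binomial g) -> generates B I -> v \in U ->
  B (lattice_binomial K v) \/ B (- lattice_binomial K v).
Proof.
move=> Bbin BI Uv; apply: NNPP => nB.
have vI : I (lattice_binomial K v) by apply/lattice_binomial_in/U_L.
case/BI: vI => s sB /(congr1 (mcoeff (pos_part v))).
rewrite mcoeff_binomial ?pos_neg_neq ?U_neq0 // raddf_sum big1_seq => [/eqP|q /= /sB].
  by rewrite oner_eq0.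
move=> Bq; have [a [b qE]] := Bbin _ Bq; rewrite qE.
have Lab : L (mnm_vec a - mnm_vec b).
  apply: (lattice_ideal_binomialP (K := K)) => //.
  by rewrite -qE; apply/BI/ideal_gen_in.
have key a' b' c : ~ (a' = pos_part v /\ b' = neg_part v) ->
    L (mnm_vec a' - mnm_vec b') ->
    (c + a')%MM = pos_part v -> (c + b')%MM = pos_part v.
  move=> nab Lab' ca; case: (@pos_part_fiber v (c + b')%MM) => //.
    by rewrite -ca !mnm_vecD opprD addrACA subrr add0r.
  (* The monomial x^c divides both x^v+ and x^v-, which are coprime; hence [c] is 0 and the excluded
     pair appears. *)
  move=> cb; case: nab.
  have c0 : c = 0%MM by apply: (@pos_neg_disjoint _ v); rewrite -?ca -?cb lem_addr.
  by move: ca cb; rewrite c0 !add0m.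
apply: mcoeffM_binomial => c; split; apply: key => //.
- by case=> aE bE; apply: nB; left; rewrite /lattice_binomial -aE -bE -qE.
- by case=> bE aE; apply: nB; right; rewrite opprB -aE -bE -qE.
- by rewrite -opprB; apply: lattice_opp.
Qed.

Lemma lattice_binomial_neq u : u != 0 -> lattice_binomial K u != 0.
Proof.
move=> u0; apply/eqP => E; have := mcoeff_binomial K (pos_neg_neq u0).
by rewrite -/(lattice_binomial K u) E mcoeff0 => /esym/eqP; rewrite oner_eq0.
Qed.

Hypothesis U_opp : forall v, v \in U -> - v \notin U.

Lemma pos_part_le_pos v v' : v \in U -> v' \in U ->
  (pos_part v <= pos_part v')%MM -> v = v'.
Proof.
move=> Uv Uv' /pos_part_leP/(U_fiber Uv' (U_L Uv))[v0|//].
by have := U_neq0 Uv; rewrite v0 eqxx.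
Qed.

(** Translation by [v] carries the vectors below v^- to vectors below v^+, where [U_fiber]
    applies. *)
Lemma U_fiberN v w : v \in U -> L w ->
  (forall i, w 0 i <= Num.max (- v 0 i) 0) -> w = 0 \/ w = - v.
Proof.
move=> Uv Lw wv; case: (@U_fiber v (w + v)) => //.
- by apply: lattice_add => //; apply: U_L.
- by move=> i; have := wv i; rewrite mxE; move: (v 0 i) (w 0 i) => x y; lia.
- by move/eqP; rewrite addr_eq0 => /eqP; right.
- by move/eqP; rewrite -subr_eq0 addrK => /eqP; left.
Qed.

(** Divisibility would give [v = - v'] by [U_fiberN], against [U_opp]. *)
Lemma pos_part_le_neg v v' : v \in U -> v' \in U ->
  ~~ (pos_part v <= neg_part v')%MM.
Proof.
move=> Uv Uv'; apply/negP; rewrite -pos_partN => /pos_part_leP vv'.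
case: (U_fiberN Uv' (U_L Uv)) => [i||E]; first by have := vv' i; rewrite mxE.
  by move=> v0; have := U_neq0 Uv; rewrite v0 eqxx.
by have := U_opp Uv'; rewrite -E Uv.
Qed.

(** Stated as an equality and not as a contradiction, because in characteristic 2 a binomial equals
    its negative. *)
Lemma lattice_binomial_opp v v' : v \in U -> v' \in U ->
  - lattice_binomial K v = lattice_binomial K v' ->
  lattice_binomial K v = lattice_binomial K v'.
Proof.
move=> Uv Uv' E; congr lattice_binomial.
have : pos_part v \in msupp (lattice_binomial K v').
  rewrite -E (perm_mem (msuppN _)) msupp_binomialE ?eqxx //.
  by rewrite pos_neg_neq ?U_neq0.
rewrite msupp_binomialE ?pos_neg_neq ?U_neq0 // => /orP[]/eqP H.
  by apply: pos_part_le_pos => //; rewrite H lepm_refl.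
by have := pos_part_le_neg Uv Uv'; rewrite H lepm_refl.
Qed.

Lemma lattice_ideal_minimal : minimal_binomial_generators I (fun g => g \in G).
Proof.
have Gbin g : g \in G -> is_binomial g.
  by case/mapP=> v _ ->; exists (pos_part v), (neg_part v).
split=> //; first exact: lattice_ideal_generated.
move=> B BG BI b /mapP[v Uv ->].
case: (generators_contain (fun g Bg => Gbin g (BG g Bg)) BI Uv) => // BN.
(* The negated binomial lies in [B], hence in [G], which forces it to equal the binomial itself. *)
have /mapP[v' Uv' E] := BG _ BN.
by rewrite (lattice_binomial_opp Uv Uv' E) -E.
Qed.

(** Choosing for each element of [G] a sign that puts it in [B] gives a generating subset of [B],
    and minimality makes this subset all of [B]. *)
Lemma lattice_ideal_minimal_unique (B : S -> Prop) :
  minimal_binomial_generators I B ->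
  exists e : S -> bool, forall b : S, B b <-> exists2 g, g \in G & b = (-1) ^+ e g * g.
Proof.
case=> Bbin BI Bmin.
pose e g := if excluded_middle_informative (B g) then false else true.
pose B' (b : S) := exists2 g, g \in G & b = (-1) ^+ e g * g.
have B'B (b : S) : B' b -> B b.
  case=> g /mapP[v Uv ->] ->; rewrite /e.
  case: excluded_middle_informative => [Bv|nBv]; first by rewrite expr0 mul1r.
  by rewrite expr1 mulN1r; case: (generators_contain Bbin BI Uv).
exists e => b; split; last exact: B'B.
apply: (Bmin B') => // f; split=> [If|].
  apply: ideal_gen_sub ((lattice_ideal_generated f).1 If) => g Gg.
  rewrite -[g](signrMK (e g)); apply: ideal_genMl; apply: ideal_gen_in.
  by exists g.
by move=> H; apply/BI; apply: ideal_gen_sub H => g /B'B; apply: ideal_gen_in.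
Qed.

(** For a neighbor [u], a covering [v] below u^+ must be [u]. If [v] is below u^- instead, then
    [u + v] is below u^+, so it is 0 or [u], and it is not [u] since [v] is nonzero. *)
Lemma neighbor_of_origin_mem u :
  neighbor_of_origin L u <-> exists2 v, v \in U & u = v \/ u = - v.
Proof.
split=> [N|].
  have [Lu u0 _] := N.
  have := N; rewrite neighbor_of_originP //; last exact: lattice_pos_entry.
    2: exact: lattice_neg_entry.
  case=> _ _ H; have [v Uv [/pos_part_leP vu|]] := U_cover Lu u0.
    exists v => //; left; case: (H v (U_L Uv) vu) => // v0.
    by have := U_neq0 Uv; rewrite v0 eqxx.
  rewrite -pos_partN => /pos_part_leP vu; exists v => //; right.
  case: (H (u + v)).
  - by apply: lattice_add => //; apply: U_L.
  - by move=> i; have := vu i; rewrite !mxE; move: (v 0 i) (u 0 i) => x y; lia.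
  - by move/eqP; rewrite addr_eq0 => /eqP.
  - move/eqP; rewrite eq_sym -subr_eq0 opprD addrA subrr sub0r oppr_eq0.
    by rewrite (negbTE (U_neq0 Uv)).
case=> v Uv uv.
have Lv := U_L Uv; have v0 := U_neq0 Uv.
have [Lu u0] : L u /\ u != 0.
  by case: uv => ->; rewrite ?oppr_eq0; split=> //; apply: lattice_opp.
rewrite neighbor_of_originP //; last exact: lattice_pos_entry.
  2: exact: lattice_neg_entry.
split=> // w Lw; case: uv => ->; first exact: U_fiber.
by move=> H; apply: U_fiberN => // i; have := H i; rewrite mxE.
Qed.

Variable lt : rel 'X_{1..r}.
(** [lt] is an arbitrary relation here, so the comparison of the two monomials is stated in both
    directions. *)
Hypothesis U_lt : forall v, v \in U -> lt (neg_part v) (pos_part v).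
Hypothesis U_gt : forall v, v \in U -> ~~ lt (pos_part v) (neg_part v).
Hypothesis U_head : forall a b, L (mnm_vec a - mnm_vec b) -> a != b -> lt b a ->
  exists2 v, v \in U & (pos_part v <= pos_part (mnm_vec a - mnm_vec b)%R)%MM.

Lemma leading_monomial_binomial v a : v \in U ->
  leading_monomial lt (lattice_binomial K v) a <-> a = pos_part v.
Proof.
move=> Uv; have vN := pos_neg_neq (U_neq0 Uv).
rewrite /leading_monomial msupp_binomialE //; split=> [[/orP[/eqP//|/eqP->] H]|->].
  have := H (pos_part v); rewrite msupp_binomialE // eqxx (negbTE (U_gt Uv)).
  by move=> /(_ isT vN).
rewrite eqxx; split=> // b; rewrite msupp_binomialE //.
by case/orP=> /eqP-> //; rewrite ?eqxx // U_lt.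
Qed.

(** A leading exponent [a] of an element of the ideal has a congruent, smaller partner [b] in the
    support. The positive part of their difference divides x^a, and by [U_head] some x^v+ divides
    it; no S-polynomials are involved. *)
Lemma lattice_groebner : groebner_basis lt I G.
Proof.
split=> [g /mapP[v Uv ->]|f].
  split; first by apply/lattice_binomial_in/U_L.
  by rewrite lattice_binomial_neq ?U_neq0.
split; apply: ideal_gen_sub => q [g [a [Ig ga ->]]]; last first.
  apply: ideal_gen_in; exists g, a; split=> //.
  by case/mapP: Ig => v Uv ->; apply/lattice_binomial_in/U_L.
have [b [gb ba Lab]] := lattice_ideal_partner L0 LB Ig ga.1.
have [|v Uv vab] := U_head Lab _ (ga.2 b gb ba); first by rewrite eq_sym.
have va := lepm_trans vab (pos_part_sub_le a b).
rewrite -(submK va) mpolyXD; apply/ideal_genMl/ideal_gen_in.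
exists (lattice_binomial K v), (pos_part v); split=> //; first exact: map_f.
by apply/leading_monomial_binomial.
Qed.

Lemma lattice_reduced_groebner : reduced_groebner_basis lt I G.
Proof.
split; first exact: lattice_groebner.
  move=> g a /mapP[v Uv ->] /(leading_monomial_binomial _ Uv)->.
  by rewrite mcoeff_binomial // pos_neg_neq ?U_neq0.
move=> g h a b /mapP[v Uv ->] /mapP[v' Uv' ->] vv'.
move=> /(leading_monomial_binomial _ Uv)->.
case/msupp_binomial=> ->; last exact: pos_part_le_neg.
by apply: contra_neqN vv' => /(pos_part_le_pos Uv Uv')->.
Qed.

End GenericLattice.

(** * Lattice points with w <= (m + 4, m + 3, 0, m + 4) *)

Lemma box_bounds (m : nat) (k1 k2 k3 : int) :
  (0 < m)%N ->
  (m + 4)%:Z * k1 - (m + 1)%:Z * k2 - k3 <= (m + 4)%:Z ->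
  - (m + 1)%:Z * k1 - 3 * k2 + (m + 3)%:Z * k3 <= (m + 3)%:Z ->
  - k1 - k2 - (m + 1)%:Z * k3 <= 0 ->
  - k1 + (m + 4)%:Z * k2 - k3 <= (m + 4)%:Z ->
  [/\ -1 <= k1 <= 2, -1 <= k2 <= 2 & -1 <= k3 <= 4].
Proof.
move=> m_gt0 h1 h2 h3 h4.
(* The multipliers below are 2x2 minors of the matrix with rows [c1], [c2], [c3]
   and the weights [n1], ..., [n4]: three of the four inequalities, weighted by
   minors, eliminate two of the unknowns [k1], [k2], [k3] (Cramer's rule). *)
have F (x : nat) (y z : int) : y <= z -> 0 <= x%:Z * (z - y).
  by move=> yz; rewrite mulr_ge0 // subr_ge0.
(* Signs supplied for [lia], which works linearly with the powers of [m] as atoms. *)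
have m2 : 0 <= m%:Z * m%:Z by [].
have m3 : 0 <= m%:Z * m%:Z * m%:Z by [].
split; apply/andP; split; rewrite leNgt; apply/negP => hk.
- have h : k1 <= -2 by lia.
  have := F (m * m + 5 * m + 5)%N _ _ h2.
  have := F (m * m + 7 * m + 9)%N _ _ h3.
  have := F (4 * m + 6)%N _ _ h4.
  have := F (m * m * m + 7 * (m * m) + 21 * m + 20)%N _ _ h.
  lia.
- have h : 3 <= k1 by lia.
  have := F (m * m + 7 * m + 9)%N _ _ h1.
  have := F (2 * m + 5)%N _ _ h2.
  have := F (m * m + 4 * m + 6)%N _ _ h4.
  have := F (m * m * m + 8 * (m * m) + 26 * m + 25)%N _ _ h.
  lia.
- have h : k2 <= -2 by lia.
  have := F (m * m + 3 * m + 4)%N _ _ h1.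
  have := F (m * m + 5 * m + 5)%N _ _ h2.
  have := F (m * m + 6 * m + 11)%N _ _ h3.
  have := F (m * m * m + 8 * (m * m) + 28 * m + 30)%N _ _ h.
  lia.
- have h : 3 <= k2 by lia.
  have := F (2 * m + 4)%N _ _ h1.
  have := F (m + 5)%N _ _ h2.
  have := F (m * m + 6 * m + 11)%N _ _ h4.
  have := F (m * m * m + 8 * (m * m) + 26 * m + 25)%N _ _ h.
  lia.
- have h : k3 <= -2 by lia.
  have := F (m + 5)%N _ _ h1.
  have := F (m * m + 7 * m + 15)%N _ _ h3.
  have := F (2 * m + 5)%N _ _ h4.
  have := F (m * m * m + 8 * (m * m) + 25 * m + 25)%N _ _ h.
  lia.
- have h : 5 <= k3 by lia.
  have := F (m * m + 5 * m + 7)%N _ _ h1.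
  have := F (m * m + 7 * m + 15)%N _ _ h2.
  have := F (m * m + 5 * m + 13)%N _ _ h4.
  have := F (m * m * m + 8 * (m * m) + 26 * m + 25)%N _ _ h.
  lia.
Qed.

(** Besides 0 and the seven vectors of [us], four triples occur: (1, 1, 0) for every m, (-1, 1, 1)
    for m <= 2, and (1, 1, -1) and (2, 2, 3) for m = 1 only. *)
Lemma box_lattice_points (m : nat) (k1 k2 k3 w1 w2 w3 w4 : int) :
  (0 < m)%N ->
  w1 = (m + 4)%:Z * k1 - (m + 1)%:Z * k2 - k3 ->
  w2 = - (m + 1)%:Z * k1 - 3 * k2 + (m + 3)%:Z * k3 ->
  w3 = - k1 - k2 - (m + 1)%:Z * k3 ->
  w4 = - k1 + (m + 4)%:Z * k2 - k3 ->
  w1 <= (m + 4)%:Z -> w2 <= (m + 3)%:Z -> w3 <= 0 -> w4 <= (m + 4)%:Z ->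
  (k1, k2, k3) \in [:: (0, 0, 0); (1, 0, 0); (0, 1, 0); (0, 0, 1); (1, 0, 1);
    (0, 1, 1); (1, 1, 1); (1, 1, 2); (1, 1, 0); (-1, 1, 1); (1, 1, -1);
    (2, 2, 3)].
Proof.
move=> m_gt0 w1E w2E w3E w4E h1 h2 h3 h4.
have [] := @box_bounds m k1 k2 k3 m_gt0; try lia.
move=> b1 b2 b3.
have e1 : k1 \in [:: -1; 0; 1; 2] by rewrite !inE; lia.
have e2 : k2 \in [:: -1; 0; 1; 2] by rewrite !inE; lia.
have e3 : k3 \in [:: -1; 0; 1; 2; 3; 4] by rewrite !inE; lia.
move: e1 e2 e3 w1E w2E w3E w4E => {b1 b2 b3}; rewrite !inE.
(* The ranges leave 4 * 4 * 6 = 96 triples; each one not listed violates one of the four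
   inequalities. *)
case/or4P=> /eqP->; case/or4P=> /eqP->;
case/or4P=> [/eqP->|/eqP->|/eqP->|/or3P[]/eqP->] => w1E w2E w3E w4E;
  by [|exfalso; lia].
Qed.

(** * Vectors and monomials in four coordinates *)

Section Coordinates.
Implicit Types (u v : 'rV[int]_4).

Lemma forall_ord4 (P : 'I_4 -> Prop) : P i1 -> P i2 -> P i3 -> P i4 -> forall i, P i.
Proof.
move=> P1 P2 P3 P4 [[|[|[|[|//]]]] lti].
- by rewrite (_ : Ordinal lti = i1) //; apply: val_inj.
- by rewrite (_ : Ordinal lti = i2) //; apply: val_inj.
- by rewrite (_ : Ordinal lti = i3) //; apply: val_inj.
- by rewrite (_ : Ordinal lti = i4) //; apply: val_inj.
Qed.

Lemma row4P u v : u 0 i1 = v 0 i1 -> u 0 i2 = v 0 i2 -> u 0 i3 = v 0 i3 ->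
  u 0 i4 = v 0 i4 -> u = v.
Proof. by move=> *; apply/rowP; apply: forall_ord4. Qed.

Lemma sum_ord4 (V : nmodType) (F : 'I_4 -> V) :
  \sum_i F i = F i1 + F i2 + F i3 + F i4.
Proof.
rewrite !big_ord_recl big_ord0 addr0 !addrA.
by congr (F _ + F _ + F _ + F _); apply: val_inj.
Qed.

Lemma prod_ord4 (R : pzSemiRingType) (F : 'I_4 -> R) :
  \prod_i F i = F i1 * F i2 * F i3 * F i4.
Proof.
rewrite !big_ord_recl big_ord0 mulr1 !mulrA.
by congr (F _ * F _ * F _ * F _); apply: val_inj.
Qed.

(** The [minn] conditions make the two monomials coprime, so that their exponents are the positive
    and negative parts of [u]. *)
Lemma lattice_binomial4 (K : fieldType) u (a1 a2 a3 a4 b1 b2 b3 b4 : nat) :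
  minn a1 b1 = 0%N -> minn a2 b2 = 0%N -> minn a3 b3 = 0%N -> minn a4 b4 = 0%N ->
  u 0 i1 = a1%:Z - b1%:Z -> u 0 i2 = a2%:Z - b2%:Z ->
  u 0 i3 = a3%:Z - b3%:Z -> u 0 i4 = a4%:Z - b4%:Z ->
  lattice_binomial K u =
    'X_i1 ^+ a1 * 'X_i2 ^+ a2 * 'X_i3 ^+ a3 * 'X_i4 ^+ a4
    - 'X_i1 ^+ b1 * 'X_i2 ^+ b2 * 'X_i3 ^+ b3 * 'X_i4 ^+ b4.
Proof.
move=> m1 m2 m3 m4 u1 u2 u3 u4.
have X4 (a : 'X_{1..4}) : 'X_[a] =
    'X_i1 ^+ a i1 * 'X_i2 ^+ a i2 * 'X_i3 ^+ a i3 * 'X_i4 ^+ a i4 :> {mpoly K[4]}.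
  by rewrite mpolyXE_id prod_ord4.
have part (x : int) (p q : nat) : minn p q = 0%N -> x = p%:Z - q%:Z ->
    absz (Num.max x 0) = p /\ absz (Num.max (- x) 0) = q by clear; lia.
have [p1 q1] := part _ _ _ m1 u1; have [p2 q2] := part _ _ _ m2 u2.
have [p3 q3] := part _ _ _ m3 u3; have [p4 q4] := part _ _ _ m4 u4.
rewrite /lattice_binomial (X4 (pos_part u)) (X4 (neg_part u)) !pos_partE !neg_partE.
by rewrite p1 p2 p3 p4 q1 q2 q3 q4.
Qed.

End Coordinates.

(** * The lattice [Lm m] and its seven distinguished vectors *)

Section Lattice.
Variable m : nat.
Implicit Types (u v w : 'rV[int]_4) (a b : 'X_{1..4}).

Lemma Lm_coord u : Lm m u -> exists k1 k2 k3 : int,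
  [/\ u 0 i1 = (m + 4)%:Z * k1 - (m + 1)%:Z * k2 - k3,
      u 0 i2 = - (m + 1)%:Z * k1 - 3 * k2 + (m + 3)%:Z * k3,
      u 0 i3 = - k1 - k2 - (m + 1)%:Z * k3
    & u 0 i4 = - k1 + (m + 4)%:Z * k2 - k3].
Proof.
by case=> k1 [k2 [k3 ->]]; exists k1, k2, k3; split; rewrite !mxE /=; lia.
Qed.

Lemma Lm0 : Lm m 0.
Proof. by exists 0, 0, 0; rewrite !scale0r !addr0. Qed.

Lemma LmB u v : Lm m u -> Lm m v -> Lm m (u - v).
Proof.
move=> [k1 [k2 [k3 ->]]] [l1 [l2 [l3 ->]]]; exists (k1 - l1), (k2 - l2), (k3 - l3).
by rewrite !scalerBl !opprD addrACA; congr (_ + _); rewrite addrACA.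
Qed.

Lemma us_Lm v : v \in us m -> Lm m v.
Proof.
have c1L : Lm m (c1 m) by exists 1, 0, 0; rewrite !scale0r scale1r !addr0.
have c2L : Lm m (c2 m) by exists 0, 1, 0; rewrite !scale0r scale1r add0r !addr0.
have c3L : Lm m (c3 m) by exists 0, 0, 1; rewrite !scale0r scale1r !add0r.
have LD u w := @lattice_add _ _ Lm0 LmB u w.
by rewrite !inE; do 6 ?[case/predU1P=> [->|]]; last move/eqP->; rewrite ?mulr2n; auto.
Qed.

Lemma usE : us m =
  [:: vec4 (m + 4)%:Z (- (m + 1)%:Z) (- 1) (- 1);
      vec4 (- (m + 1)%:Z) (- 3) (- 1) (m + 4)%:Z;
      vec4 (- 1) (m + 3)%:Z (- (m + 1)%:Z) (- 1);
      vec4 (m + 3)%:Z 2 (- (m + 2)%:Z) (- 2);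
      vec4 (- (m + 2)%:Z) m%:Z (- (m + 2)%:Z) (m + 3)%:Z;
      vec4 2 (- 1) (- (m + 3)%:Z) (m + 2)%:Z;
      vec4 1 (m + 2)%:Z (- (2 * m + 4)%:Z) (m + 1)%:Z].
Proof. by congr [:: _; _; _; _; _; _; _]; apply: row4P; rewrite !mxE /=; lia. Qed.

(** Turns a claim about all seven vectors into seven goals on plain integers, within reach of
    [lia]. *)
Lemma us_coord_ind (P : int -> int -> int -> int -> Prop) :
  P (m + 4)%:Z (- (m + 1)%:Z) (- 1) (- 1) ->
  P (- (m + 1)%:Z) (- 3) (- 1) (m + 4)%:Z ->
  P (- 1) (m + 3)%:Z (- (m + 1)%:Z) (- 1) ->
  P (m + 3)%:Z 2 (- (m + 2)%:Z) (- 2) ->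
  P (- (m + 2)%:Z) m%:Z (- (m + 2)%:Z) (m + 3)%:Z ->
  P 2 (- 1) (- (m + 3)%:Z) (m + 2)%:Z ->
  P 1 (m + 2)%:Z (- (2 * m + 4)%:Z) (m + 1)%:Z ->
  forall v, v \in us m -> P (v 0 i1) (v 0 i2) (v 0 i3) (v 0 i4).
Proof.
move=> P1 P2 P3 P4 P5 P6 P7 v; rewrite usE !inE.
by do 6 ?[case/predU1P=> [->|]]; last move/eqP->; rewrite !mxE.
Qed.

Hypothesis m_gt0 : (0 < m)%N.

Lemma us_full v : v \in us m -> forall i, v 0 i != 0.
Proof.
move=> Uv; suff /and4P[v1 v2 v3 v4] :
  [&& v 0 i1 != 0, v 0 i2 != 0, v 0 i3 != 0 & v 0 i4 != 0] by apply: forall_ord4.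
pose P (a b c d : int) := [&& a != 0, b != 0, c != 0 & d != 0].
by refine (us_coord_ind (P := P) _ _ _ _ _ _ _ Uv); rewrite /P; lia.
Qed.

Lemma us_neq0 v : v \in us m -> v != 0.
Proof.
by move=> /us_full/(_ i1); apply: contra_neq => ->; rewrite mxE.
Qed.

Lemma us_i3 v : v \in us m -> v 0 i3 < 0.
Proof. by move: v; refine (us_coord_ind (P := fun _ _ c _ => c < 0) _ _ _ _ _ _ _); lia. Qed.

Lemma us_opp v : v \in us m -> - v \notin us m.
Proof.
by move/us_i3 => v3; apply/negP => /us_i3; rewrite mxE oppr_lt0 ltNge ltW.
Qed.

(** The positive parts of the seven vectors are at most (m + 4, m + 3, 0, m + 4), so [w] lies in the
    box; the twelve candidates are then tested against each vector. *)
Lemma us_fiber v w : v \in us m -> Lm m w ->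
  (forall i, w 0 i <= Num.max (v 0 i) 0) -> w = 0 \/ w = v.
Proof.
move=> Uv Lw H; have [k1 [k2 [k3 [w1 w2 w3 w4]]]] := Lm_coord Lw.
suff : (w 0 i1, w 0 i2, w 0 i3, w 0 i4) = (0, 0, 0, 0) \/
    (w 0 i1, w 0 i2, w 0 i3, w 0 i4) = (v 0 i1, v 0 i2, v 0 i3, v 0 i4).
  by case=> -[E1 E2 E3 E4]; [left|right]; apply: row4P; rewrite ?E1 ?E2 ?E3 ?E4 ?mxE.
move: (H i1) (H i2) (H i3) (H i4) w1 w2 w3 w4 => {H Lw}.
move: (w 0 i1) (w 0 i2) (w 0 i3) (w 0 i4) => x1 x2 x3 x4 {w}.
pose P (v1 v2 v3 v4 : int) := x1 <= Num.max v1 0 -> x2 <= Num.max v2 0 ->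
  x3 <= Num.max v3 0 -> x4 <= Num.max v4 0 ->
  x1 = (m + 4)%:Z * k1 - (m + 1)%:Z * k2 - k3 ->
  x2 = - (m + 1)%:Z * k1 - 3 * k2 + (m + 3)%:Z * k3 ->
  x3 = - k1 - k2 - (m + 1)%:Z * k3 ->
  x4 = - k1 + (m + 4)%:Z * k2 - k3 ->
  (x1, x2, x3, x4) = (0, 0, 0, 0) \/ (x1, x2, x3, x4) = (v1, v2, v3, v4).
refine (us_coord_ind (P := P) _ _ _ _ _ _ _ Uv) => {v Uv} h1 h2 h3 h4 w1 w2 w3 w4;
have b1 : x1 <= (m + 4)%:Z by [lia]; have b2 : x2 <= (m + 3)%:Z by [lia];
have b3 : x3 <= 0 by [lia]; have b4 : x4 <= (m + 4)%:Z by [lia];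
have := box_lattice_points m_gt0 w1 w2 w3 w4 b1 b2 b3 b4;
move: w1 w2 w3 w4; rewrite !inE => w1 w2 w3 w4 K; move: K w1 w2 w3 w4;
(do 11 ?[case/predU1P=> [[-> -> ->]|]]; last case/eqP=> -> -> ->) => w1 w2 w3 w4;
(exfalso; lia) || (by left; congr (_, _, _, _); lia)
  || (by right; congr (_, _, _, _); lia).
Qed.

(** The disjuncts say in turn that the monomial of u_1^+, ..., u_7^+ divides that of x^+. When the
    first three, pure powers, all fail, the point lies in the box. *)
Lemma head_inequalities (k1 k2 k3 x1 x2 x3 x4 : int) :
  x1 = (m + 4)%:Z * k1 - (m + 1)%:Z * k2 - k3 ->
  x2 = - (m + 1)%:Z * k1 - 3 * k2 + (m + 3)%:Z * k3 ->
  x3 = - k1 - k2 - (m + 1)%:Z * k3 ->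
  x4 = - k1 + (m + 4)%:Z * k2 - k3 ->
  x3 <= 0 -> (k1, k2, k3) != (0, 0, 0) ->
  [|| (m + 4)%:Z <= x1, (m + 4)%:Z <= x4, (m + 3)%:Z <= x2,
      ((m + 3)%:Z <= x1) && (2 <= x2), (m%:Z <= x2) && ((m + 3)%:Z <= x4),
      (2 <= x1) && ((m + 2)%:Z <= x4)
    | [&& 1 <= x1, (m + 2)%:Z <= x2 & (m + 1)%:Z <= x4]].
Proof.
move=> w1 w2 w3 w4 u3 k0; case: leP => //= b1; case: leP => //= b4.
case: leP => //= b2.
have := box_lattice_points m_gt0 w1 w2 w3 w4 (ltW b1) (ltW b2) u3 (ltW b4).
move: w1 w2 w3 w4 k0 b1 b2 b4; rewrite !inE => w1 w2 w3 w4 k0 b1 b2 b4 K.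
by move: K w1 w2 w3 w4 k0; (do 11 ?[case/predU1P=> [[-> -> ->]|]]; last case/eqP=> -> -> ->)
  => // w1 w2 w3 w4 _; lia.
Qed.

Lemma head_exists u : Lm m u -> u != 0 -> u 0 i3 <= 0 ->
  exists2 v, v \in us m & (pos_part v <= pos_part u)%MM.
Proof.
move=> Lu u0 u3; have [k1 [k2 [k3 [w1 w2 w3 w4]]]] := Lm_coord Lu.
have k0 : (k1, k2, k3) != (0, 0, 0).
  apply: contra_neq u0 => -[k10 k20 k30]; apply: row4P; rewrite [RHS]mxE.
  - by rewrite w1 k10 k20 k30; lia.
  - by rewrite w2 k10 k20 k30; lia.
  - by rewrite w3 k10 k20 k30; lia.
  - by rewrite w4 k10 k20 k30; lia.
have := head_inequalities w1 w2 w3 w4 u3 k0.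
have head j : (j < 7)%N -> (us m)`_j 0 i1 <= Num.max (u 0 i1) 0 ->
    (us m)`_j 0 i2 <= Num.max (u 0 i2) 0 -> (us m)`_j 0 i3 <= Num.max (u 0 i3) 0 ->
    (us m)`_j 0 i4 <= Num.max (u 0 i4) 0 ->
    exists2 v, v \in us m & (pos_part v <= pos_part u)%MM.
  move=> j7 h1 h2 h3 h4; exists (us m)`_j; first exact: mem_nth.
  by apply/pos_part_leP; apply: forall_ord4.
move: head u3 {w1 w2 w3 w4}; rewrite usE.
move: (u 0 i1) (u 0 i2) (u 0 i3) (u 0 i4) => x1 x2 x3 x4 head _.
case/or4P=> [H|H|H|/or4P[H|H|H|H]].
- by apply: (head 0%N) => //; rewrite mxE /=; lia.
- by apply: (head 1%N) => //; rewrite mxE /=; lia.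
- by apply: (head 2%N) => //; rewrite mxE /=; lia.
- by apply: (head 3%N) => //; rewrite mxE /=; lia.
- by apply: (head 4%N) => //; rewrite mxE /=; lia.
- by apply: (head 5%N) => //; rewrite mxE /=; lia.
- by apply: (head 6%N) => //; rewrite mxE /=; lia.
Qed.

End Lattice.

(** * The weighted reverse lexicographic order on congruent monomials *)

Section WeightedRevlex.
Variable m : nat.
Implicit Types (u v : 'rV[int]_4) (a b : 'X_{1..4}).

Definition weight (i : 'I_4) : nat := nth 0%N [:: n1 m; n2 m; n3 m; n4 m] i.

Lemma weight_gt0 i : (0 < weight i)%N.
Proof.
by move: i; apply: forall_ord4; rewrite /weight /= /n1 /n2 /n3 /n4 addn_gt0 orbT.
Qed.

(** The weights are, up to one common sign, the signed maximal minors of the matrix with rows [c1],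
    [c2], [c3], hence orthogonal to each row. *)
Lemma weight_Lm u : Lm m u -> \sum_i (weight i)%:Z * u 0 i = 0.
Proof.
case/Lm_coord=> k1 [k2 [k3 [w1 w2 w3 w4]]].
rewrite sum_ord4 w1 w2 w3 w4 /weight /= /n1 /n2 /n3 /n4 !expnS expn0 muln1.
lia.
Qed.

Lemma weighted_degree_eq a b : Lm m (mnm_vec a - mnm_vec b) ->
  weighted_degree m a = weighted_degree m b.
Proof.
move/weight_Lm; rewrite sum_ord4 !mxE /weight /= /weighted_degree.
by move: (n1 m) (n2 m) (n3 m) (n4 m) (a i1) (a i2) (a i3) (a i4); lia.
Qed.

Lemma last_nonzero_rcons (s : seq int) x :
  last_nonzero (rcons s x) = if x == 0 then last_nonzero s else x.
Proof.
by rewrite /last_nonzero filter_rcons; case: eqP => //= _; rewrite last_rcons.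
Qed.

(** The tie-break lists x_3 last, so distinct x_3-exponents decide it, the larger exponent giving
    the smaller monomial. *)
Lemma wrevlex_lt_i3 a b : weighted_degree m a = weighted_degree m b ->
  a i3 != b i3 -> wrevlex_lt m a b = (b i3 < a i3)%N.
Proof.
rewrite /wrevlex_lt => ->; rewrite ltnn eqxx /= => ab.
rewrite (last_nonzero_rcons [:: _; _; _]) subr_eq0 eqz_nat (negbTE ab).
by rewrite subr_gt0 ltz_nat.
Qed.

Lemma Gm_lattice_binomial (K : fieldType) :
  Gm m K = [seq lattice_binomial K v | v <- us m].
Proof.
rewrite usE /= /Gm; congr [:: _; _; _; _; _; _; _].
- rewrite (@lattice_binomial4 K _ (m + 4) 0 0 0 0 (m + 1) 1 1)
    ?mxE /= ?min0n ?minn0 //; try lia.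
  by rewrite !expr0 !expr1 !mulr1 !mul1r.
- rewrite (@lattice_binomial4 K _ 0 0 0 (m + 4) (m + 1) 3 1 0)
    ?mxE /= ?min0n ?minn0 //; try lia.
  by rewrite !expr0 !expr1 !mulr1 !mul1r.
- rewrite (@lattice_binomial4 K _ 0 (m + 3) 0 0 1 0 (m + 1) 1)
    ?mxE /= ?min0n ?minn0 //; try lia.
  by rewrite !expr0 !expr1 !mulr1 !mul1r.
- rewrite (@lattice_binomial4 K _ (m + 3) 2 0 0 0 0 (m + 2) 2)
    ?mxE /= ?min0n ?minn0 //; try lia.
  by rewrite !expr0 !mulr1 !mul1r.
- rewrite (@lattice_binomial4 K _ 0 m 0 (m + 3) (m + 2) 0 (m + 2) 0)
    ?mxE /= ?min0n ?minn0 //; try lia.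
  by rewrite !expr0 !mulr1 !mul1r.
- rewrite (@lattice_binomial4 K _ 2 0 0 (m + 2) 0 1 (m + 3) 0)
    ?mxE /= ?min0n ?minn0 //; try lia.
  by rewrite !expr0 !expr1 !mulr1 !mul1r.
- rewrite (@lattice_binomial4 K _ 1 (m + 2) 0 (m + 1) 0 0 (2 * m + 4) 0)
    ?mxE /= ?min0n ?minn0 //; try lia.
  by rewrite !expr0 !expr1 !mulr1 !mul1r.
Qed.

Hypothesis m_gt0 : (0 < m)%N.

(** The third entry of [u] or of [- u] is at most 0, the case settled by [head_exists]. *)
Lemma us_cover u : Lm m u -> u != 0 -> exists2 v, v \in us m &
  (pos_part v <= pos_part u)%MM \/ (pos_part v <= neg_part u)%MM.
Proof.
move=> Lu u0; have [u3|u3] := leP (u 0 i3) 0.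
  by have [v Uv vu] := head_exists m_gt0 Lu u0 u3; exists v => //; left.
have [|||v Uv vu] := @head_exists m m_gt0 (- u).
- exact: (lattice_opp (@Lm0 m) (@LmB m)).
- by rewrite oppr_eq0.
- by rewrite mxE oppr_le0 ltW.
by exists v => //; right; rewrite -pos_partN.
Qed.

(** Congruent monomials have equal weighted degree, so the larger one cannot have the larger
    x_3-exponent, and [head_exists] applies. *)
Lemma us_head a b : Lm m (mnm_vec a - mnm_vec b) -> a != b -> wrevlex_lt m b a ->
  exists2 v, v \in us m & (pos_part v <= pos_part (mnm_vec a - mnm_vec b)%R)%MM.
Proof.
move=> Lab ab lt_ba; apply: head_exists => //.
  by rewrite subr_eq0; apply: contra_neq ab => /mnm_vec_inj.
rewrite !mxE subr_le0 lez_nat; have [->//|ab3] := eqVneq (a i3) (b i3).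
move: lt_ba; rewrite wrevlex_lt_i3 1?eq_sym // => [/ltnW //|].
by rewrite (weighted_degree_eq Lab).
Qed.

Lemma us_parts v : v \in us m ->
  weighted_degree m (pos_part v) = weighted_degree m (neg_part v) /\
  (pos_part v i3 < neg_part v i3)%N.
Proof.
move=> Uv; split.
  by apply: weighted_degree_eq; rewrite pos_part_sub_neg; apply: us_Lm.
have := us_i3 m_gt0 Uv; rewrite pos_partE neg_partE.
by move: (v 0 i3) => x; lia.
Qed.

Lemma us_lt v : v \in us m -> wrevlex_lt m (neg_part v) (pos_part v).
Proof.
by case/us_parts=> w lt3; rewrite wrevlex_lt_i3 // gtn_eqF.
Qed.

Lemma us_gt v : v \in us m -> ~~ wrevlex_lt m (pos_part v) (neg_part v).
Proof.
by case/us_parts=> w lt3; rewrite wrevlex_lt_i3 // ?ltn_eqF // -leqNgt ltnW.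
Qed.

End WeightedRevlex.

(** * The general results on [U] applied to [us m] and the weights *)

Theorem theorem3p7 (K : fieldType) (m : nat) (hm : (1 <= m)%N) :
  [/\ reduced_groebner_basis (wrevlex_lt m) (lattice_ideal (K := K) (Lm m))
        (Gm m K),
      generic_lattice_ideal K (Lm m),
      minimal_binomial_generators (lattice_ideal (Lm m))
        (fun g => g \in Gm m K) /\
      (forall B : {mpoly K[4]} -> Prop,
         minimal_binomial_generators (lattice_ideal (Lm m)) B ->
         exists e : {mpoly K[4]} -> bool, forall b : {mpoly K[4]},
           B b <-> exists2 g, g \in Gm m K & b = (-1) ^+ e g * g)
    & forall u : 'rV[int]_4,
        neighbor_of_origin (Lm m) u <->
        exists2 v, v \in us m & u = v \/ u = - v].
Proof.
have L0 := @Lm0 m; have LB := @LmB m; have w0 := @weight_gt0 m.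
have wL := @weight_Lm m; have UL := @us_Lm m.
have Ufull := @us_full m hm; have U0 := @us_neq0 m hm; have Uopp := @us_opp m hm.
have Ufib := @us_fiber m hm; have Ucov := @us_cover m hm.
rewrite Gm_lattice_binomial; split.
- apply: lattice_reduced_groebner => //; [exact: us_lt|exact: us_gt|exact: us_head].
- exact: (lattice_ideal_generic K L0 LB w0 wL UL Ufull Ucov).
- split; first exact: (lattice_ideal_minimal K L0 LB w0 wL UL Ufull U0 Ucov Ufib Uopp).
  exact: (lattice_ideal_minimal_unique L0 LB w0 wL UL Ufull U0 Ucov Ufib).
- exact: (neighbor_of_origin_mem L0 LB w0 wL UL U0 Ucov Ufib).
Qed.
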